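(* Assume $G$ satisfies the Plausibility Assumption. Let $p$ be a polynomial in the indeterminates $x_{i,c}$ whose variable set $S=\mathrm{vbls}(p)$ satisfies $|S|\le\deg(p)$ and $|S|\le\zeta\cdot\mathrm{SMALL}$, and assume that $p(x)=0$ for every $x$ in the support of $\eta_{\mathrm{cl}(S)}$. Then $\tilde{\mathbb E}$ satisfies the identity $p=0$.
   Context: Fix a finite alphabet $\Omega$ with $|\Omega|=q\ge2$, integers $K\ge3$ and $3\le\tau\le K$. $G$ is a bipartite factor graph between variable-vertices $[n]$ and constraint-vertices; each constraint-vertex $f$ has an ordered neighbourhood $N(f)$ with $\tau-1\le|N(f)|\le K$ and a $(\tau-1)$-wise uniform distribution $\mu_f$ on $\Omega^{N(f)}$. A subgraph is an edge-induced subgraph $H=G[A]$ (possibly empty, not necessarily connected); $\mathrm{vbls}(H),\mathrm{cons}(H)$ are its variable-/constraint-vertices, $N_H(f)$ the variables adjacent to $f$ in $H$. $H$ is a $\tau$-subgraph if $|N_H(f)|\ge\tau$ for all $f\in\mathrm{cons}(H)$; a leaf is a variable-vertex of degree $1$ in $H$. Parameters $1\le\mathrm{SMALL}\le n/2$, $0<\zeta<1$, $K\le\zeta\cdot\mathrm{SMALL}$; $H$ is small if $|\mathrm{cons}(H)|\le\mathrm{SMALL}$. For a $\tau$-subgraph $H$: credits $=$ number of leaves; debits $=\sum_{i}\max(\deg_H(i)-2,0)+\sum_{f}(|N_H(f)|-\tau)$; revenue $R(H)=$ credits $-$ debits; income $I(H)=R(H)-\zeta|\mathrm{cons}(H)|$;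 plausible means $I(H)\ge0$. Plausibility Assumption: every $\tau$-subgraph with at most $2\cdot\mathrm{SMALL}$ constraint-vertices is plausible. $H$ is $S$-closed (for a variable set $S$) if it is a $\tau$-subgraph with all leaves in $S$; $\mathrm{cl}(S)$ is the union of all small $S$-closed $\tau$-subgraphs. For a small subgraph $H$, the planted distribution $\eta_H$ on $\Omega^n$: draw independently $w_f\sim\mu_f$ for $f\in\mathrm{cons}(H)$, regard $w_{f,i}$ ($i\in N_H(f)$) as the value suggested for $i$, condition on all suggestions to each $i\in\mathrm{vbls}(H)$ agreeing and let $x_i$ be the common value, and choose $x_i$ for $i\notin\mathrm{vbls}(H)$ independently uniformly. Indeterminates $x_{i,c}$ ($i\in[n],c\in\Omega$); for a polynomial $p$ in them, $\mathrm{vbls}(p)$ is the set of $i$ with some $x_{i,c}$ appearing in $p$, $\deg_{\mathrm{mlin}}(p)=\max|\mathrm{vbls}(M)|$ over monomials $M$ of $p$, and for $x\in\Omega^n$, $p(x)$ denotes evaluation at $x_{i,c}=\mathbf 1[x_i=c]$. $\tilde{\mathbb E}$ is the linear functional on polynomials of multilinear degree at most $\zeta\cdot\mathrm{SMALL}$ defined on monomials by $\tilde{\mathbb E}[M]=\mathbb E_{x\sim\eta_{\mathrm{cl}(\mathrm{vbls}(M))}}[M(x)]$. $\tilde{\mathbb E}$ satisfies the identity $p=0$ if $\tilde{\mathbb E}[pq]=0$ for every polynomial $q$ with $\deg(pq)\le\zeta\cdot\mathrm{SMALL}$. *)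

(* Defs.v *)
From mathcomp Require Import all_boot all_order all_algebra reals.
From mathcomp Require Import mpoly.

Set Implicit Arguments.
Unset Strict Implicit.
Unset Printing Implicit Defensive.

Import Order.TTheory GRing.Theory Num.Theory.

Local Open Scope ring_scope.

Section Distributions.
Variables (R : realType) (Omega V : finType).

Definition is_distribution (mu : {ffun V -> Omega} -> R) : Prop :=
  (forall w, 0 <= mu w) /\ \sum_w mu w = 1.

(* The marginal of mu on every t-element set T of coordinates is uniform on
   Omega^T; an element of Omega^T is given by any of its extensions a. *)
Definition wise_uniform (t : nat) (mu : {ffun V -> Omega} -> R) : Prop :=
  forall T : {set V}, #|T| = t -> forall a : {ffun V -> Omega},
    \sum_(w : {ffun V -> Omega} | [forall i in T, w i == a i]) mu w
      = (#|Omega|%:R ^+ t)^-1.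

End Distributions.

(* [seq_sub (nbr f)] is the finite type of the elements of the list nbr f, so
   [{ffun seq_sub (nbr f) -> Omega}] is Omega^{N(f)}. *)
Record factor_graph (R : realType) (Omega : finType) (n K tau : nat) :=
  FactorGraph {
    constr : finType;
    nbr : constr -> seq 'I_n;
    mu : forall f : constr, {ffun seq_sub (nbr f) -> Omega} -> R;
    nbr_uniq : forall f, uniq (nbr f);
    nbr_size : forall f, (tau - 1 <= size (nbr f) <= K)%N;
    mu_distribution : forall f, is_distribution (@mu f);
    mu_wise_uniform : forall f, wise_uniform (tau - 1) (@mu f)
  }.

Section FactorGraph.
Variables (R : realType) (Omega : finType) (n K tau : nat).
Variable G : factor_graph R Omega n K tau.

(* An edge of G is a constraint-vertex together with one of its neighbours. *)
Definition edge : Type := {f : constr G & seq_sub (nbr f)}.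

Definition mk_edge (f : constr G) (j : seq_sub (nbr f)) : edge :=
  Tagged (fun g : constr G => seq_sub (nbr g)) j.

Definition edge_con (e : edge) : constr G := tag e.
Definition edge_var (e : edge) : 'I_n := val (tagged e).

(* An edge-induced subgraph G[A] is represented by its edge set A. *)
Definition subgraph := {set edge}.

Implicit Types (H : subgraph) (S : {set 'I_n}).

Definition vbls_in H : {set 'I_n} := [set edge_var e | e in H].
Definition cons_in H : {set constr G} := [set edge_con e | e in H].
Definition nbrs_in H (f : constr G) : {set 'I_n} :=
  [set edge_var e | e in H & edge_con e == f].
Definition deg_in H (i : 'I_n) : nat := #|[set e in H | edge_var e == i]|.

Definition tau_subgraph H : bool :=
  [forall f in cons_in H, (tau <= #|nbrs_in H f|)%N].

Definition leaves H : {set 'I_n} := [set i in vbls_in H | deg_in H i == 1%N].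

(* Natural-number subtraction is truncated: it gives the max with 0 in the
   first sum, and is exact in the second one when H is a tau-subgraph. *)
Definition credits H : nat := #|leaves H|.
Definition debits H : nat :=
  (\sum_(i in vbls_in H) (deg_in H i - 2)
   + \sum_(f in cons_in H) (#|nbrs_in H f| - tau))%N.
Definition revenue H : R := (credits H)%:R - (debits H)%:R.
Definition income (zeta : R) H : R := revenue H - zeta * #|cons_in H|%:R.
Definition plausible (zeta : R) H : bool := 0 <= income zeta H.

Definition plausibility_assumption (SMALL zeta : R) : Prop :=
  forall H, tau_subgraph H -> #|cons_in H|%:R <= 2 * SMALL -> plausible zeta H.

Definition small (SMALL : R) H : bool := #|cons_in H|%:R <= SMALL.

Definition closed_subgraph S H : bool := tau_subgraph H && (leaves H \subset S).

Definition cl (SMALL : R) S : subgraph :=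
  \bigcup_(H : subgraph | small SMALL H && closed_subgraph S H) H.

Definition assignment := {ffun 'I_n -> Omega}.

Definition suggestions H : finType :=
  {dffun forall f : {f : constr G | f \in cons_in H},
     {ffun seq_sub (nbr (val f)) -> Omega}}.

Definition suggestion_prob H (w : suggestions H) : R :=
  \prod_(f : {f : constr G | f \in cons_in H}) mu (w f).

Definition consistent H (w : suggestions H) : bool :=
  [forall f, [forall j : seq_sub (nbr (val f)), (mk_edge j \in H) ==>
    [forall f', [forall j' : seq_sub (nbr (val f')), (mk_edge j' \in H) ==>
      (val j == val j') ==> (w f j == w f' j')]]]].

Definition agrees H (w : suggestions H) (x : assignment) : bool :=
  [forall f, [forall j : seq_sub (nbr (val f)), (mk_edge j \in H) ==>
    (w f j == x (val j))]].

(* The quotient is the probability, conditionally on the suggestions being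
   consistent, that their common values on vbls_in H are those of x (agrees w x
   implies consistent w). The last factor accounts for the uniform choices
   outside vbls_in H. If consistency has probability 0, planted H is 0
   everywhere. *)
Definition planted H (x : assignment) : R :=
  (\sum_(w : suggestions H | agrees w x) suggestion_prob w)
  / (\sum_(w : suggestions H | consistent w) suggestion_prob w)
  * (#|Omega|%:R ^+ #|~: vbls_in H|)^-1.

Definition in_support (eta : assignment -> R) (x : assignment) : Prop :=
  eta x != 0.

End FactorGraph.

Section Polynomials.
Variables (R : realType) (Omega : finType) (n : nat).

(* The indeterminate x_{i,c} is the one of index enum_rank (i, c). *)
Definition nindet : nat := #|{: 'I_n * Omega}|.
Definition indet (i : 'I_n) (c : Omega) : 'I_nindet := enum_rank (i, c).
Definition indet_poly := {mpoly R[nindet]}.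

Definition vbls_mon (m : 'X_{1..nindet}) : {set 'I_n} :=
  [set i | [exists c, m (indet i c) != 0%N]].

Definition vbls_poly (p : indet_poly) : {set 'I_n} :=
  \bigcup_(m <- msupp p) vbls_mon m.

(* Total degree; the zero polynomial gets degree 0. *)
Definition deg (p : indet_poly) : nat := (msize p).-1.

Definition deg_mlin (p : indet_poly) : nat :=
  (\max_(m <- msupp p) #|vbls_mon m|)%N.

Definition eval (p : indet_poly) (x : {ffun 'I_n -> Omega}) : R :=
  p.@[fun k : 'I_nindet => let ic := enum_val k in (x ic.1 == ic.2)%:R].

Lemma card_vbls_mon (m : 'X_{1..nindet}) : (#|vbls_mon m| <= mdeg m)%N.
Proof.
set s := [set k | m k != 0%N].
have sub : vbls_mon m \subset [set (enum_val k).1 | k in s].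
  apply/subsetP=> i; rewrite inE => /existsP[c hc].
  by apply/imsetP; exists (indet i c); rewrite ?inE ?enum_rankK.
apply: (leq_trans (subset_leq_card sub)).
apply: (leq_trans (leq_imset_card _ _)).
rewrite mdegE -sum1_card [leqRHS](bigID (mem s)) /=.
by apply: leq_trans (leq_addr _ _); apply: leq_sum => k; rewrite inE lt0n.
Qed.

Lemma deg_mlin_le_deg (p : indet_poly) : (deg_mlin p <= deg p)%N.
Proof.
apply/bigmax_leqP_seq => m mp _; apply: leq_trans (card_vbls_mon m) _.
by rewrite -ltnS (leq_trans (msize_mdeg_lt mp)) ?leqSpred.
Qed.

End Polynomials.

Section PseudoExpectation.
Variables (R : realType) (Omega : finType) (n K tau : nat).
Variable G : factor_graph R Omega n K tau.

Definition pseudo_expectation_mon (SMALL : R)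
    (m : 'X_{1..nindet Omega n}) : R :=
  \sum_(x : {ffun 'I_n -> Omega})
    planted (cl G SMALL (vbls_mon m)) x * eval 'X_[m] x.

(* Meaningful only when deg_mlin p <= zeta * SMALL; by deg_mlin_le_deg, all
   the uses in satisfies_identity are of this kind. *)
Definition pseudo_expectation (SMALL : R) (p : indet_poly R Omega n) : R :=
  \sum_(m <- msupp p) p@_m * pseudo_expectation_mon SMALL m.

Definition satisfies_identity (SMALL zeta : R)
    (p : indet_poly R Omega n) : Prop :=
  forall q : indet_poly R Omega n, (deg (p * q))%:R <= zeta * SMALL ->
    pseudo_expectation SMALL (p * q) = 0.

End PseudoExpectation.

(* Main.v *)
(* For a set H of edges let weight H x be the product over the constraints f of
   the probability that w_f agrees with x on the neighbours of f in H; the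
   planted distribution of H is proportional to weight H. Let phi depend only on
   x_S. If the edge e of H is incident to a constraint having fewer than tau
   neighbours in H (whose marginal is then uniform), or to a leaf of H outside S
   (over whose value one can sum), then deleting e multiplies the sum of
   phi * weight H by |Omega|. A small H strictly containing cl S has such an
   edge outside cl S, as otherwise it would be S-closed and contained in cl S.
   So all small H containing cl S have the same planted mean of phi.
   Plausibility makes cl T small for |T| <= zeta * SMALL. Taking
   T = vbls p :|: vbls m for a monomial m of q, the pseudo-expectation of p m is
   its mean under the planted distribution of cl T, on whose support p vanishes:
   the mean of p ^ 2 is the same as for cl (vbls p), that is 0. *)
Require Import Defs.
From mathcomp Require Import all_boot all_order all_algebra reals.
From mathcomp Require Import mpoly.

Set Implicit Arguments.
Unset Strict Implicit.
Unset Printing Implicit Defensive.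

Import Order.TTheory GRing.Theory Num.Theory.

Local Open Scope ring_scope.

(** Distributivity for functions with varying codomains; it factors the sum over independent
    suggestions $w_f$, each of which lives on its own $N(f)$. *)
Lemma sum_dffun_prod (R : comNzRingType) (I : finType) (T_ : I -> finType)
    (F : forall i, T_ i -> R) :
  \sum_(w : {dffun forall i, T_ i}) \prod_i F i (w i) =
  \prod_i \sum_(a : T_ i) F i a.
Proof.
rewrite (reindex (@dffun_of_fprod I T_)); last first.
  exact/onW_bij/dffun_of_fprod_bij.
transitivity (\sum_(t : fprod T_) \prod_i [ffun a => F i a] (t i)).
  by apply: eq_bigr => t _; apply: eq_bigr => i _; rewrite !ffunE.
rewrite (big_fprod _ _ (fun i => [ffun a => F i a])).
rewrite -(bigA_distr_big_dep (tagged_with T_)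
            (fun i => untag 0 [ffun a => F i a])).
apply: eq_bigr => i _; rewrite -(big_tag (fun i => [ffun a => F i a])).
by apply: eq_bigr => a _; rewrite ffunE.
Qed.

(** * Coordinate updates and marginals *)

Section Marginals.
Variables (R : realType) (Omega V : finType).
Implicit Types (x a : {ffun V -> Omega}) (T S : {set V}).

Definition upd x i c : {ffun V -> Omega} :=
  [ffun k => if k == i then c else x k].

(** The swap of [x i] with [c] is an involution on the pairs [(x, c)]. *)
Lemma sum_upd (h : {ffun V -> Omega} -> R) i :
  \sum_x \sum_c h (upd x i c) = #|Omega|%:R * \sum_x h x.
Proof.
rewrite pair_big /=.
pose s (u : {ffun V -> Omega} * Omega) := (upd u.1 i u.2, u.1 i).
have sK : involutive s.
  case=> x c; rewrite /s /= /upd; congr pair; last by rewrite ffunE eqxx.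
  by apply/ffunP=> k; rewrite !ffunE; case: eqP => // ->.
rewrite (reindex_inj (inv_inj sK)) /=.
rewrite -(pair_big xpredT xpredT (fun x c => h (upd (upd x i c) i (x i)))) /=.
rewrite mulr_sumr; apply: eq_bigr => x _.
rewrite (eq_bigr (fun=> h x)) => [|c _]; first by rewrite sumr_const mulr_natl.
by congr h; apply/ffunP=> k; rewrite !ffunE; case: eqP => // ->.
Qed.

Definition depends_on S (phi : {ffun V -> Omega} -> R) :=
  forall x y : {ffun V -> Omega}, {in S, x =1 y} -> phi x = phi y.

Lemma depends_onS S T phi : S \subset T -> depends_on S phi -> depends_on T phi.
Proof. by move=> /subsetP ST dphi x y xy; apply: dphi => i /ST; apply: xy. Qed.

Lemma depends_on_upd S phi x i c :
  depends_on S phi -> i \notin S -> phi (upd x i c) = phi x.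
Proof.
move=> dphi iS; apply: dphi => k kS; rewrite ffunE.
by case: eqP iS => // <-; rewrite kS.
Qed.

Variable mu : {ffun V -> Omega} -> R.

Definition marginal T a : R :=
  \sum_(w : {ffun V -> Omega} | [forall i in T, w i == a i]) mu w.

Lemma marginal_del T i a : i \in T ->
  \sum_c marginal T (upd a i c) = marginal (T :\ i) a.
Proof.
move=> iT; rewrite /marginal [RHS](partition_big
  (fun w : {ffun V -> Omega} => w i) xpredT) //=.
apply: eq_bigr => c _; apply: eq_bigl => w.
apply/forall_inP/andP => [wT|[/forall_inP wT /eqP wi] k kT].
  split; last by have := wT i iT; rewrite ffunE eqxx.
  apply/forall_inP=> k /setD1P[ki kT].
  by have := wT k kT; rewrite ffunE (negbTE ki).
rewrite ffunE; case: (eqVneq k i) => [->|ki]; first by rewrite wi.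
by apply: wT; rewrite !inE ki.
Qed.

Lemma marginal_eq T (a b : {ffun V -> Omega}) :
  {in T, a =1 b} -> marginal T a = marginal T b.
Proof.
move=> ab; apply: eq_bigl => w.
by apply: eq_forallb_in => i iT; rewrite ab.
Qed.

Hypothesis mu_distr : is_distribution mu.

Lemma marginal_ge0 T a : 0 <= marginal T a.
Proof. by apply: sumr_ge0 => w _; case: mu_distr. Qed.

Lemma marginal0 a : marginal set0 a = 1.
Proof.
case: mu_distr => _ <-; apply: eq_bigl => w.
by apply/forall_inP=> i; rewrite inE.
Qed.

(** [wise_uniform] speaks only of sets of exactly [t] coordinates. A smaller [T] is enlarged by a
    coordinate outside it, which exists since [t <= #|V|], and the value there is summed out. *)
Lemma marginal_uniform t T a : (0 < #|Omega|)%N ->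
  wise_uniform t mu -> (#|T| <= t <= #|V|)%N ->
  marginal T a = (#|Omega|%:R ^+ #|T|)^-1.
Proof.
move=> q_gt0 mut /andP[].
have q0 : #|Omega|%:R != 0 :> R by rewrite pnatr_eq0 -lt0n.
move: {-1}(t - #|T|)%N (erefl (t - #|T|)%N) => d.
elim: d T a => [|d IHd] T a td Tt tV.
  have eqT : #|T| = t by apply/eqP; rewrite eqn_leq Tt -subn_eq0 td.
  by rewrite /marginal mut // eqT.
have ltTt : (#|T| < t)%N by rewrite -subn_gt0 td.
have /set0Pn[i] : ~: T != set0.
  by rewrite -card_gt0 cardsCs setCK subn_gt0 (leq_trans ltTt).
rewrite inE => iT.
have cT : #|i |: T| = #|T|.+1 by rewrite cardsU1 iT.
rewrite -[T in LHS](setU1K iT) -marginal_del ?setU11 //.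
rewrite (eq_bigr (fun=> (#|Omega|%:R ^+ #|T|.+1)^-1)) => [|c _].
  by rewrite sumr_const exprS invfM -mulrnAl -(mulr_natl _^-1) divff ?mul1r.
by rewrite -cT IHd // cT // subnS td.
Qed.

End Marginals.

(** * Weights of subgraphs and deletion of an edge *)

Section FactorGraph.
Variables (R : realType) (Omega : finType) (n K tau : nat).
Variable G : factor_graph R Omega n K tau.
Implicit Types (H : subgraph G) (S T : {set 'I_n}) (f : constr G) (e : edge G).
Implicit Type (x : assignment Omega n).
Local Notation q := (#|Omega|%:R : R).

(** The edges of [H] at [f], as coordinates of the domain on which [mu] at [f] lives. *)
Definition edges_at H f : {set seq_sub (nbr f)} := [set j | mk_edge j \in H].

Lemma edges_at_del H f (j : seq_sub (nbr f)) :
  edges_at (H :\ mk_edge j) f = edges_at H f :\ j.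
Proof.
apply/setP=> k; rewrite !inE; congr (~~ _ && _).
by rewrite /mk_edge eq_Tagged.
Qed.

Lemma edges_at_del_neq H f f' (j : seq_sub (nbr f)) : f' != f ->
  edges_at (H :\ mk_edge j) f' = edges_at H f'.
Proof.
move=> neq; apply/setP=> k; rewrite !inE.
suff -> : mk_edge k != mk_edge j by [].
by apply: contra neq => /eqP/(congr1 (@edge_con _ _ _ _ _ G))/= ->.
Qed.

Lemma card_edges_at H f : #|edges_at H f| = #|nbrs_in H f|.
Proof.
rewrite -(card_imset _ (@val_inj _ _ (seq_sub (nbr f)))).
congr #|pred_of_set _|; apply/setP=> i; apply/imsetP/imsetP=> -[].
  move=> j; rewrite inE => jH ->.
  by exists (mk_edge j) => //; rewrite inE jH /=.
case=> f' j; rewrite inE => /andP[jH /= /eqP ff'] ->.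
by case: _ / ff' in jH *; exists j => //; rewrite inE.
Qed.

Definition con_prob H f x : R :=
  marginal (@mu _ _ _ _ _ G f) (edges_at H f) [ffun j => x (val j)].

(** The product runs over all constraints of [G], so its index set is unchanged when an edge is
    deleted; a constraint without edges in [H] contributes 1 by [marginal0]. *)
Definition weight H x : R := \prod_f con_prob H f x.

Lemma weight_ge0 H x : 0 <= weight H x.
Proof. by apply: prodr_ge0 => f _; apply/marginal_ge0/mu_distribution. Qed.

Hypothesis Omega_gt0 : (0 < #|Omega|)%N.

Lemma q_neq0 : q != 0. Proof. by rewrite pnatr_eq0 -lt0n. Qed.

(** At most [tau - 1] coordinates are involved at [f], so both marginals are uniform, on sets whose
    sizes differ by one. Here the identity is pointwise in [x]. *)
Lemma weight_del_low H f (j : seq_sub (nbr f)) x : mk_edge j \in H ->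
  (#|edges_at H f| < tau)%N -> q * weight H x = weight (H :\ mk_edge j) x.
Proof.
move=> jH low; rewrite /weight (bigD1 f) //= [RHS](bigD1 f) //= mulrA.
congr (_ * _); last first.
  by apply: eq_bigr => f' ff'; rewrite /con_prob edges_at_del_neq.
have jE : j \in edges_at H f by rewrite inE.
have /andP[szN _] := @nbr_size _ _ _ _ _ G f.
have cV : #|{: seq_sub (nbr f)}| = size (nbr f).
  by rewrite card_seq_sub ?nbr_uniq.
have cE := cardsD1 j (edges_at H f); rewrite jE add1n in cE.
have lowE : (#|edges_at H f| <= tau - 1)%N.
  by rewrite subn1 -ltnS (ltn_predK low).
rewrite /con_prob edges_at_del.
have U := @mu_wise_uniform _ _ _ _ _ G f.
have D := @mu_distribution _ _ _ _ _ G f.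
rewrite !(marginal_uniform _ Omega_gt0 U) ?cV ?szN ?andbT //.
  by rewrite cE exprS invfM mulrA divff ?q_neq0 ?mul1r.
by apply: leq_trans lowE; rewrite cE.
Qed.

Lemma deg1_edge H e e' : e \in H -> e' \in H -> deg_in H (edge_var e) = 1%N ->
  edge_var e' = edge_var e -> e' = e.
Proof.
move=> eH e'H /eqP/cards1P[e0 E0] ee'.
have : e \in [set e0 in H | edge_var e0 == edge_var e] by rewrite inE eH /=.
have : e' \in [set e0 in H | edge_var e0 == edge_var e].
  by rewrite inE e'H ee' /=.
by rewrite E0 !inE => /eqP -> /eqP ->.
Qed.

(** Resampling the value at the leaf affects only the factor at [f], and summing that factor over
    the value removes [j] from its marginal. *)
Lemma sum_weight_del_leaf S H f (j : seq_sub (nbr f)) phi : mk_edge j \in H ->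
  val j \notin S -> deg_in H (val j) = 1%N -> depends_on S phi ->
  q * \sum_x phi x * weight H x = \sum_x phi x * weight (H :\ mk_edge j) x.
Proof.
move=> jH jS deg1 dphi; rewrite -(sum_upd _ (val j)).
apply: eq_bigr => x _; rewrite /= /weight.
under eq_bigr do rewrite (depends_on_upd _ _ dphi jS) (bigD1 f) //=.
rewrite -mulr_sumr (bigD1 f) //=; congr (_ * _).
rewrite (eq_bigr (fun c => con_prob H f (upd x (val j) c) *
   \prod_(f' | f' != f) con_prob (H :\ mk_edge j) f' x)) => [|c _].
  rewrite -mulr_suml; congr (_ * _).
  have jE : j \in edges_at H f by rewrite inE.
  rewrite /con_prob edges_at_del -(marginal_del _ _ jE).
  apply: eq_bigr => c _; congr marginal; apply/ffunP=> k.
  by rewrite !ffunE (inj_eq val_inj).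
congr (_ * _); apply: eq_bigr => f' ff'.
(* An edge at [f'] reaching [val j] would be a second edge at a variable of degree 1. *)
rewrite /con_prob edges_at_del_neq //; apply: marginal_eq => k.
rewrite inE => kH; rewrite !ffunE; case: eqP => // kj.
have /= E := deg1_edge jH kH deg1 kj.
by move/eqP: ff'; case; exact: (congr1 (@edge_con _ _ _ _ _ G) E).
Qed.

(** * The planted distribution as a normalised weight *)

Lemma sum_agreeing_suggestions H x :
  \sum_(w : suggestions H | agrees w x) suggestion_prob w = weight H x.
Proof.
rewrite /weight (bigID (fun f => f \in cons_in H)) /=.
rewrite [X in _ * X]big1 => [|f fH].
  (* Agreement with [x] is a separate condition at each constraint; putting its indicator into the
     factors makes the sum of products split. *)
  pose F (f : {f | f \in cons_in H})
      (w : {ffun seq_sub (nbr (val f)) -> Omega}) : R :=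
    if [forall j in edges_at H (val f), w j == [ffun j => x (val j)] j]
    then mu w else 0.
  rewrite mulr1 (big_sub (cons_in H) (con_prob H ^~ x)).
  transitivity (\prod_f \sum_w F f w); last first.
    by apply: eq_bigr => f _; rewrite /con_prob /marginal [RHS]big_mkcond.
  rewrite -sum_dffun_prod.
  rewrite big_mkcond; apply: eq_bigr => w _; rewrite /agrees /suggestion_prob.
  case: ifPn => [/forallP wx|/forallPn[f]].
    apply: eq_bigr => f _; rewrite /F ifT //; apply/forall_inP=> j; rewrite inE.
    by have /forallP/(_ j)/implyP wxj := wx f; rewrite ffunE.
  rewrite negb_forall => /existsP[j]; rewrite negb_imply => /andP[jH wj].
  rewrite (bigD1 f) //= {1}/F ifF ?mul0r //; apply/negbTE/forall_inPn.
  by exists j; rewrite ?inE // ffunE.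
rewrite /con_prob (_ : edges_at H f = set0) ?marginal0 //; last first.
  apply/setP=> j; rewrite !inE; apply: contraNF fH => jH.
  by apply/imsetP; exists (mk_edge j).
exact: mu_distribution.
Qed.

Lemma card_agreeing_assignments H (w : suggestions H) :
  #|[pred x | agrees w x]| =
  if consistent w then (#|Omega| ^ #|~: vbls_in H|)%N else 0%N.
Proof.
case: ifPn => [cw|ncw]; last first.
  apply: eq_card0 => x; rewrite !inE; apply: contraNF ncw => wx.
  apply/forallP=> f; apply/forall_inP=> j jH; apply/forallP=> f'.
  apply/forall_inP=> j' j'H; apply/implyP=> /eqP jj'.
  have /forallP/(_ f)/forall_inP/(_ j jH)/eqP -> := wx.
  by have /forallP/(_ f')/forall_inP/(_ j' j'H)/eqP -> := wx; rewrite jj'.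
(* The values allowed at [i]: exactly one if [i] is in [vbls_in H], by consistency, and all of
   [Omega] otherwise. *)
pose F i := [pred c | [forall f, [forall j : seq_sub (nbr (val f)),
  (mk_edge j \in H) ==> (val j == i) ==> (w f j == c)]]].
have -> : #|[pred x | agrees w x]| =
    #|(family F : simpl_pred (assignment Omega n))|.
  apply: eq_card => x; rewrite !inE; apply/forallP/familyP => [wx i|wx f].
    rewrite inE; apply/forallP=> f; apply/forall_inP=> j jH.
    apply/implyP=> /eqP <-.
    by have /forall_inP := wx f; apply.
  apply/forall_inP=> j jH.
  have /forallP/(_ f)/forall_inP/(_ j jH) := wx (val j).
  by rewrite eqxx.
rewrite card_family foldrE big_image /= (bigID (mem (vbls_in H))) /=.
rewrite big1 ?mul1n => [|i /imsetP[[f j] jH ->]].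
  rewrite (eq_bigr (fun=> #|Omega|)) => [|i iH].
    rewrite prod_nat_const; congr (_ ^ _)%N.
    by apply: eq_card => i; rewrite !inE.
  apply: eq_card => c; rewrite !inE; apply/forallP=> f.
  apply/forall_inP=> j jH; apply/implyP=> /eqP ji.
  by case/negP: iH; rewrite -ji; apply/imsetP; exists (mk_edge j).
have fH : f \in cons_in H by apply/imsetP; exists (mk_edge j).
rewrite -(card1 (w (exist _ f fH) j)); apply: eq_card => c; rewrite !inE.
apply/forallP/eqP => [Fc|-> f'].
  have /forall_inP/(_ j jH) := Fc (exist _ f fH).
  by rewrite eqxx => /eqP.
apply/forall_inP=> j' j'H; apply/implyP=> jj'.
have /forallP/(_ f')/forall_inP/(_ j' j'H) := cw.
by move=> /forallP/(_ (exist _ f fH))/forall_inP/(_ j jH); rewrite jj'.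
Qed.

(** Double counting of agreeing pairs of suggestions and assignments: each consistent [w] is counted
    [#|Omega| ^ #|~: vbls_in H|] times. If the total weight is 0, both sides are 0 by the convention
    for inverses. *)
Lemma plantedE H x : planted H x = weight H x / \sum_y weight H y.
Proof.
rewrite /planted sum_agreeing_suggestions -mulrA -invfM; congr (_ / _).
under [RHS]eq_bigr do rewrite -sum_agreeing_suggestions.
rewrite (exchange_big_dep xpredT) //= mulr_suml big_mkcond.
apply: eq_bigr => w _; rewrite sumr_const.
have := card_agreeing_assignments w; rewrite /in_mem /= => ->.
by case: ifP => _; rewrite ?mulr0n // -[RHS]mulr_natr natrX.
Qed.

Lemma planted_ge0 H x : 0 <= planted H x.
Proof.
rewrite plantedE divr_ge0 ?weight_ge0 // sumr_ge0 // => y _.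
exact: weight_ge0.
Qed.

(** * Closed subgraphs and the size of the closure *)

Lemma vbls_inP H i :
  reflect (exists2 e, e \in H & edge_var e = i) (i \in vbls_in H).
Proof. by apply: (iffP imsetP) => -[e eH ei]; exists e. Qed.

Lemma deg_inS H H' i : H \subset H' -> (deg_in H i <= deg_in H' i)%N.
Proof.
move=> HH'; apply/subset_leq_card/subsetP=> e; rewrite !inE => /andP[eH ->].
by rewrite (subsetP HH').
Qed.

Lemma deg_in_gt0 H e : e \in H -> (0 < deg_in H (edge_var e))%N.
Proof.
by move=> eH; rewrite card_gt0; apply/set0Pn; exists e; rewrite inE eH /=.
Qed.

(** The degree in [H] is positive because of [e], and at most the degree in [H']. *)
Lemma leaf_subgraph H H' e : H \subset H' -> e \in H ->
  edge_var e \in leaves H' -> edge_var e \in leaves H.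
Proof.
move=> HH' eH; rewrite !inE => /andP[_ /eqP deg1].
rewrite eqn_leq -{1}deg1 deg_inS // deg_in_gt0 // !andbT.
by apply/imsetP; exists e.
Qed.

Lemma nbrs_inS H H' f : H \subset H' -> nbrs_in H f \subset nbrs_in H' f.
Proof.
move=> HH'; apply/subsetP=> i /imsetP[e]; rewrite inE => /andP[eH ef] ->.
by apply/imsetP; exists e; rewrite // inE (subsetP HH').
Qed.

Lemma tau_subgraphU H1 H2 :
  tau_subgraph H1 -> tau_subgraph H2 -> tau_subgraph (H1 :|: H2).
Proof.
move=> /forall_inP t1 /forall_inP t2; apply/forall_inP=> f.
case/imsetP=> e; rewrite inE => /orP[eH|eH] ef.
  apply: leq_trans (t1 f _) (subset_leq_card (nbrs_inS f (subsetUl _ _))).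
  by apply/imsetP; exists e.
apply: leq_trans (t2 f _) (subset_leq_card (nbrs_inS f (subsetUr _ _))).
by apply/imsetP; exists e.
Qed.

(** A leaf of the union lies on an edge of one of the two subgraphs, and is already a leaf there. *)
Lemma closed_subgraphU S H1 H2 : closed_subgraph S H1 -> closed_subgraph S H2 ->
  closed_subgraph S (H1 :|: H2).
Proof.
move=> /andP[t1 /subsetP l1] /andP[t2 /subsetP l2].
rewrite /closed_subgraph tau_subgraphU //=; apply/subsetP=> i iL.
have : i \in vbls_in (H1 :|: H2) by move: iL; rewrite inE => /andP[].
case/vbls_inP=> e eU ei; rewrite -ei in iL *.
case/setUP: eU => eH; [apply: l1|apply: l2].
  exact: leaf_subgraph (subsetUl _ _) eH iL.
exact: leaf_subgraph (subsetUr _ _) eH iL.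
Qed.

Lemma closed_subgraph0 S : closed_subgraph S (set0 : subgraph G).
Proof.
apply/andP; split; first by apply/forall_inP=> f /imsetP[e]; rewrite inE.
by apply/subsetP=> i; rewrite inE => /andP[/imsetP[e]]; rewrite inE.
Qed.

Variables (SMALL zeta : R).

Lemma cl_closed S : closed_subgraph S (cl G SMALL S).
Proof.
apply: (big_ind (fun H => closed_subgraph S H)) => [|H1 H2|H /andP[]] //.
  exact: closed_subgraph0.
exact: closed_subgraphU.
Qed.

Lemma cl_sup S H :
  small SMALL H -> closed_subgraph S H -> H \subset cl G SMALL S.
Proof. by move=> sH cH; apply: (bigcup_sup H); rewrite sH. Qed.

Lemma closed_subgraphS S T H :
  S \subset T -> closed_subgraph S H -> closed_subgraph T H.
Proof.
by move=> ST /andP[tH lH]; rewrite /closed_subgraph tH (subset_trans lH).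
Qed.

Lemma clS S T : S \subset T -> cl G SMALL S \subset cl G SMALL T.
Proof.
move=> ST; apply/bigcupsP=> H /andP[sH cH].
exact: cl_sup (closed_subgraphS ST cH).
Qed.

(** Nonnegative income bounds [zeta * #|cons_in H|] by the number of leaves, hence by [#|S|] and by
    [zeta * SMALL]. *)
Lemma small_plausible S H : 0 < zeta -> #|S|%:R <= zeta * SMALL ->
  closed_subgraph S H -> plausible zeta H -> small SMALL H.
Proof.
move=> z0 hS /andP[_ /subset_leq_card lS]; rewrite /plausible /income /revenue.
rewrite subr_ge0 => hp; rewrite /small -(ler_pM2l z0); apply: le_trans hS.
apply: le_trans hp _; rewrite lerBlDr -natrD ler_nat.
exact: leq_trans lS (leq_addr _ _).
Qed.

(** The union is formed one subgraph at a time. Two small closed subgraphs have together at most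
    [2 * SMALL] constraints, so their union is plausible, and [small_plausible] makes it small
    again. *)
Lemma cl_small S : 0 < zeta -> 0 <= SMALL ->
  plausibility_assumption G SMALL zeta ->
  #|S|%:R <= zeta * SMALL -> small SMALL (cl G SMALL S).
Proof.
move=> z0 s0 plaus hS.
suff /andP[] :
  small SMALL (cl G SMALL S) && closed_subgraph S (cl G SMALL S) by [].
apply: (big_ind (fun H => small SMALL H && closed_subgraph S H)) => //.
  by rewrite closed_subgraph0 /small /cons_in imset0 cards0 s0.
move=> H1 H2 /andP[s1 c1] /andP[s2 c2].
have cU := closed_subgraphU c1 c2; rewrite cU andbT.
apply: (small_plausible z0 hS cU); apply: plaus; first by case/andP: cU.
apply: (@le_trans _ _ (#|cons_in H1|%:R + #|cons_in H2|%:R)).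
  by rewrite -natrD ler_nat /cons_in imsetU leq_card_setU.
by rewrite mulr_natl mulr2n lerD.
Qed.

(* Otherwise H would be S-closed, hence contained in cl S. *)
Lemma removable_edge S H : small SMALL H -> cl G SMALL S \proper H ->
  exists e, [/\ e \in H, e \notin cl G SMALL S &
    (#|edges_at H (edge_con e)| < tau)%N \/
    edge_var e \notin S /\ deg_in H (edge_var e) = 1%N].
Proof.
move=> sH /properP[clH [e0 e0H e0cl]].
have /andP[/forall_inP tcl /subsetP lcl] := cl_closed S.
have : ~~ closed_subgraph S H.
  by apply: contra e0cl => cH; apply: subsetP e0H; exact: cl_sup.
rewrite negb_and => /orP[/forall_inPn[f /imsetP[e eH ->]]|/subsetPn[i iL iS]].
  rewrite -ltnNge => low; exists e.
  split=> //; last by left; rewrite card_edges_at.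
  (* If [e] were in the closure, its constraint would have at least [tau] neighbours there, hence in
     [H]. *)
  apply: contraL low => ecl; rewrite -leqNgt.
  apply: leq_trans (tcl (edge_con e) _) (subset_leq_card (nbrs_inS _ clH)).
  by apply/imsetP; exists e.
have : i \in vbls_in H by move: iL; rewrite inE => /andP[].
case/vbls_inP=> e eH ei; rewrite -ei in iL iS.
exists e; split=> //; last first.
  by right; split=> //; move: iL; rewrite inE => /andP[_ /eqP].
by apply: contra iS => ecl; apply/lcl/(leaf_subgraph clH ecl).
Qed.

Lemma smallS H H' : H \subset H' -> small SMALL H' -> small SMALL H.
Proof.
by move=> HH'; apply: le_trans; rewrite ler_nat subset_leq_card ?imsetS.
Qed.

(** * Planted means under removal of edges outside the closure *)

(** Induction on the number of edges outside the closure: deleting a removable edge keeps [H] small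
    and above the closure, and costs one factor [q]. *)
Lemma sum_weight_cl S H : small SMALL H -> cl G SMALL S \subset H ->
  forall phi, depends_on S phi ->
  q ^+ #|H :\: cl G SMALL S| * \sum_x phi x * weight H x =
  \sum_x phi x * weight (cl G SMALL S) x.
Proof.
move: {2}#|_| (erefl #|H :\: cl G SMALL S|) => d.
elim: d H => [|d IHd] H dH sH clH phi dphi.
  have /eqP : H :\: cl G SMALL S == set0 by rewrite -cards_eq0 dH.
  move/eqP; rewrite setD_eq0 => Hcl; rewrite dH mul1r.
  by have /eqP -> : H == cl G SMALL S by rewrite eqEsubset Hcl.
have pH : cl G SMALL S \proper H.
  by rewrite properEcard clH -subn_gt0 -cardsDS // dH.
have [[f j] [eH ecl rem]] := removable_edge sH pH.
have cH' : cl G SMALL S \subset H :\ mk_edge j by rewrite subsetD1 clH.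
have dH' : #|(H :\ mk_edge j) :\: cl G SMALL S| = d.
  move: dH; rewrite (cardsD1 (mk_edge j)) inE ecl eH add1n setDDl setUC -setDDl.
  by case.
rewrite -(IHd _ dH' (smallS (subD1set _ _) sH) cH' phi dphi) dH dH'.
rewrite exprSr -mulrA; congr (_ * _).
case: rem => [low|[jS deg1]]; last exact: sum_weight_del_leaf dphi.
rewrite mulr_sumr; apply: eq_bigr => x _.
by rewrite mulrCA (weight_del_low _ eH).
Qed.

(** Applied to [phi] and to the constant 1, [sum_weight_cl] gives the same power of [q] in the
    numerator and the denominator. *)
Lemma planted_cl S H phi : small SMALL H -> cl G SMALL S \subset H ->
  depends_on S phi ->
  \sum_x planted H x * phi x = \sum_x planted (cl G SMALL S) x * phi x.
Proof.
move=> sH clH dphi.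
have mean H' : \sum_x planted H' x * phi x =
    (\sum_x phi x * weight H' x) / (\sum_x 1 * weight H' x).
  under [X in _ / X]eq_bigr do rewrite mul1r.
  rewrite mulr_suml; apply: eq_bigr => x _.
  by rewrite plantedE mulrAC [weight _ _ * _]mulrC.
rewrite !mean -!(sum_weight_cl sH clH) //.
by rewrite -mulf_div divff ?mul1r // expf_neq0 // q_neq0.
Qed.

End FactorGraph.

(** * Variables and evaluation of polynomials *)

Section Polynomials.
Variables (R : realType) (Omega : finType) (n : nat).
Implicit Types (p : indet_poly R Omega n) (m : 'X_{1..nindet Omega n}).

Lemma eval_mon p x :
  eval p x = \sum_(m <- msupp p) p@_m * eval 'X_[m] x.
Proof.
by rewrite /eval mevalE; apply: eq_bigr => m _; rewrite mevalX.
Qed.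

Lemma eval_mon_depends m :
  depends_on (vbls_mon m) (eval ('X_[m] : indet_poly R Omega n)).
Proof.
move=> x y xy; rewrite /eval !mevalX; apply: eq_bigr => k _.
have [->|mk] := eqVneq (m k) 0%N; first by rewrite !expr0.
rewrite xy // inE; apply/existsP; exists (enum_val k).2.
by rewrite /indet -surjective_pairing enum_valK.
Qed.

Lemma vbls_mon_sub p m : m \in msupp p -> vbls_mon m \subset vbls_poly p.
Proof. by move=> mp; rewrite /vbls_poly (big_rem m) //= subsetUl. Qed.

Lemma vbls_monD m m' : vbls_mon (m + m')%MM = vbls_mon m :|: vbls_mon m'.
Proof.
apply/setP=> i; rewrite !inE; apply/existsP/orP => [[c]|].
  rewrite mnmDE addn_eq0 negb_and => /orP[mc|mc].
    by left; apply/existsP; exists c.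
  by right; apply/existsP; exists c.
by case=> /existsP[c mc]; exists c; rewrite mnmDE addn_eq0 negb_and mc ?orbT.
Qed.

Lemma eval_depends p : depends_on (vbls_poly p) (eval p).
Proof.
move=> x y xy; rewrite eval_mon [RHS]eval_mon.
apply: eq_big_seq => m mp; congr (_ * _).
exact: (depends_onS (vbls_mon_sub mp) (@eval_mon_depends m)).
Qed.

End Polynomials.

(** * Linearity of the pseudo-expectation, and its planted form *)

Section PseudoExpectation.
Variables (R : realType) (Omega : finType) (n K tau : nat).
Variable G : factor_graph R Omega n K tau.
Variable SMALL : R.
Implicit Types (p q : indet_poly R Omega n).
Local Notation pE := (pseudo_expectation G SMALL).

(** A common list of monomials is what allows polynomials with different supports to be compared in
    the proof of linearity. *)
Lemma pseudo_expectation_supp p (r : seq 'X_{1..nindet Omega n}) :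
  uniq r -> {subset msupp p <= r} ->
  pE p = \sum_(m <- r) p@_m * pseudo_expectation_mon G SMALL m.
Proof.
move=> ur pr; rewrite [RHS](bigID (fun m => m \in msupp p)) /=.
rewrite [X in _ + X]big1 => [|m mp].
  rewrite addr0 -big_filter; apply: perm_big.
  apply: uniq_perm; rewrite ?filter_uniq ?msupp_uniq // => m.
  by rewrite mem_filter; case: (boolP (m \in msupp p)) => // /pr ->.
by rewrite (memN_msupp_eq0 mp) mul0r.
Qed.

Lemma pseudo_expectation_linear c p q : pE (c *: p + q) = c * pE p + pE q.
Proof.
pose r := undup (msupp p ++ msupp q).
have pr : {subset msupp p <= r} by move=> m; rewrite mem_undup mem_cat => ->.
have qr : {subset msupp q <= r}.
  by move=> m; rewrite mem_undup mem_cat orbC => ->.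
rewrite !(@pseudo_expectation_supp _ r) ?undup_uniq // => [|m].
  rewrite mulr_sumr -big_split; apply: eq_bigr => m _ /=.
  by rewrite mcoeffD mcoeffZ mulrDl mulrA.
apply: contraLR => mr; rewrite -mcoeff_eq0 mcoeffD mcoeffZ.
rewrite !memN_msupp_eq0 ?mulr0 ?addr0 //; apply: contra mr.
  exact: qr.
exact: pr.
Qed.

Lemma pseudo_expectation0 : pE 0 = 0.
Proof. by rewrite /pseudo_expectation msupp0 big_nil. Qed.

Lemma pseudo_expectation_mul p q :
  pE (p * q) = \sum_(m <- msupp q) q@_m * pE (p * 'X_[m]).
Proof.
rewrite [q in LHS]mpolyE mulr_sumr.
elim: (msupp q) => [|m s IHs]; first by rewrite !big_nil pseudo_expectation0.
by rewrite !big_cons -scalerAr pseudo_expectation_linear IHs.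
Qed.

(** Each monomial comes with its own closure; all of these lie in the small [cl G SMALL T], so
    [planted_cl] replaces them by one genuine distribution. *)
Lemma pseudo_expectation_planted p (T : {set 'I_n}) : (0 < #|Omega|)%N ->
  small SMALL (cl G SMALL T) -> {in msupp p, forall m, vbls_mon m \subset T} ->
  pE p = \sum_x planted (cl G SMALL T) x * eval p x.
Proof.
move=> Omega_gt0 sT pT; under eq_bigr do rewrite eval_mon mulr_sumr.
rewrite exchange_big /=; apply: eq_big_seq => m mp.
rewrite /pseudo_expectation_mon.
rewrite -(planted_cl Omega_gt0 sT (clS _ _ (pT m mp))
                     (@eval_mon_depends _ _ _ m)).
by rewrite mulr_sumr; apply: eq_bigr => x _; rewrite mulrCA.
Qed.

End PseudoExpectation.

Theorem theorem5p17 (R : realType) (Omega : finType) (n K tau : nat)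
  (SMALL zeta : R) (G : factor_graph R Omega n K tau)
  (hOmega : (2 <= #|Omega|)%N) (hK : (3 <= K)%N) (htau : (3 <= tau <= K)%N)
  (hSMALL : 1 <= SMALL <= n%:R / 2) (hzeta : 0 < zeta < 1)
  (hKzeta : K%:R <= zeta * SMALL)
  (hG : plausibility_assumption G SMALL zeta)
  (p : indet_poly R Omega n)
  (hdeg : (#|vbls_poly p| <= deg p)%N)
  (hvbls : #|vbls_poly p|%:R <= zeta * SMALL)
  (hp : forall x : {ffun 'I_n -> Omega},
      in_support (planted (cl G SMALL (vbls_poly p))) x -> eval p x = 0) :
  satisfies_identity G SMALL zeta p.
Proof.
move=> q hq; have Omega_gt0 : (0 < #|Omega|)%N by apply: leq_trans hOmega.
have z0 : 0 < zeta by case/andP: hzeta.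
have s0 : 0 <= SMALL by case/andP: hSMALL => /(le_trans ler01).
(* Zero polynomials are set aside because the degree of a product is additive only for nonzero
   factors. *)
have [->|p0] := eqVneq p 0; first by rewrite mul0r pseudo_expectation0.
have [->|q0] := eqVneq q 0; first by rewrite mulr0 pseudo_expectation0.
have degM : deg (p * q) = (deg p + deg q)%N.
  rewrite /deg msizeM //.
  have : (0 < msize p)%N by rewrite lt0n msize_poly_eq0.
  have : (0 < msize q)%N by rewrite lt0n msize_poly_eq0.
  by case: (msize p) (msize q) => [|a] [|b] //=; rewrite addnS.
rewrite pseudo_expectation_mul big_seq big1 // => m mq.
pose T := vbls_poly p :|: vbls_mon m.
have hT : #|T|%:R <= zeta * SMALL.
  (* [#|T|] is at most [deg p + deg q], by [hdeg] and since [m] is a monomial of [q]; this sum is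
     the degree of [p * q]. *)
  apply: le_trans hq; rewrite ler_nat degM.
  apply: leq_trans (leq_card_setU _ _) (leq_add hdeg _).
  apply: leq_trans (card_vbls_mon m) _.
  by rewrite -ltnS (leq_trans (msize_mdeg_lt mq)) ?leqSpred.
have sT : small SMALL (cl G SMALL T) by apply: cl_small hT.
rewrite (pseudo_expectation_planted Omega_gt0 sT) => [|m'].
  (* The mean of [p ^ 2] only depends on the marginal on vbls p, and that of
     cl (vbls p) makes it vanish. *)
  have sq0 : \sum_x planted (cl G SMALL T) x * eval p x ^+ 2 = 0.
    rewrite (planted_cl (phi := fun x => eval p x ^+ 2) Omega_gt0 sT
                        (clS _ _ (subsetUl _ _))) => [|x y xy].
      apply: big1 => x _; have [->|/hp ->] :=
        eqVneq (planted (cl G SMALL (vbls_poly p)) x) 0.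
        by rewrite mul0r.
      by rewrite expr0n mulr0.
    by rewrite (eval_depends xy).
  have pos x : 0 <= planted (cl G SMALL T) x * eval p x ^+ 2.
    by rewrite mulr_ge0 ?sqr_ge0 // planted_ge0.
  (* Nonnegative terms with sum 0 all vanish, so [p] is 0 wherever the planted probability is
     nonzero, and so is its product with the monomial. *)
  rewrite big1 ?mulr0 // => x _; move/eqP: sq0.
  rewrite psumr_eq0 // => /allP/(_ x);
  rewrite mem_index_enum mulf_eq0 sqrf_eq0 => /(_ isT) /orP[] /eqP hx.
    by rewrite hx mul0r.
  by rewrite /eval rmorphM /= -/(eval p x) hx mul0r mulr0.
rewrite (perm_mem (msuppMX p m)) => /mapP[m1 m1p ->].
by rewrite vbls_monD setUC setSU // vbls_mon_sub.
Qed.
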